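(* Let $\mathcal P\in\{\mathrm{lAXp},\mathrm{lCXp},\mathrm{gAXp},\mathrm{gCXp}\}$. The problem $\mathrm{DT}\text{-}\mathcal P_{\subseteq}$ of finding an inclusion-minimal explanation of type $\mathcal P$ for a decision tree can be solved in polynomial time.
   Context: An example over a finite set $F$ of binary features is a map $e:F\to\{0,1\}$. A decision tree (DT) is a rooted binary tree in which every inner node is labelled by a feature and has exactly one $0$-child and one $1$-child, and every leaf is labelled $0$ or $1$; an example $e$ is classified by starting at the root, moving from a node labelled $f$ to its $e(f)$-child, and returning the label of the leaf reached. $F(M)$ denotes the feature set of a model $M$. Explanations. For a model $M$, an example $e:F(M)\to\{0,1\}$ and a class $c\in\{0,1\}$: (lAXp) a local abductive explanation for $e$ is a set $A\subseteq F(M)$ such that $M(e')=M(e)$ for every example $e'$ agreeing with $e$ on $A$; (lCXp) a local contrastive explanation for $e$ is a set $A\subseteq F(M)$ such that some example $e'$ with $M(e')\ne M(e)$ differs from $e$ only on features in $A$; (gAXp) a global abductive explanation for $c$ is a partial assignment $\tau:F'\to\{0,1\}$, $F'\subseteq F(M)$, such that $M(e)=c$ for every example $e$ agreeing with $\tau$; (gCXp) a global contrastive explanation for $c$ is a partial assignment $\tau:F'\to\{0,1\}$, $F'\subseteq F(M)$, such that $M(e)\neq c$ for every example $e$ agreeing with $\tau$. For a class $\mathcal M$ of models, $\mathcal M\text{-}X_{\subseteq}$ is the problem: given $M\in\mathcal M$ and an example $e$ (for lAXp, lCXp) or a class $c$ (for gAXp, gCXp), find an inclusion-minimal explanation of type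 $X$ (or report that no explanation exists). *)

(* Defs.v *)
From HB Require Import structures.
From mathcomp Require Import all_boot.

Set Implicit Arguments.
Unset Strict Implicit.
Unset Printing Implicit Defensive.

(** * Model of computation

    The WHILE language of N. D. Jones (Computability and Complexity from a
    Programming Perspective, MIT Press, 1997) in three-address form: finitely
    many variables ranging over binary trees. *)

Inductive data : Type :=
| Nil
| Cons of data & data.

Fixpoint data_size (d : data) : nat :=
  if d is Cons a b then (data_size a + data_size b).+1 else 1.

Definition hd (d : data) : data := if d is Cons a _ then a else Nil.
Definition tl (d : data) : data := if d is Cons _ b then b else Nil.

Inductive expr : Type :=
| ENil
| EVar of nat
| ECons of nat & nat
| EHd of nat
| ETl of nat.

Inductive cmd : Type :=
| Skip
| Assign of nat & expr
| Seq of cmd & cmd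
| If of nat & cmd & cmd
| While of nat & cmd.

Definition store : Type := nat -> data.

Definition eval (s : store) (e : expr) : data :=
  match e with
  | ENil => Nil
  | EVar x => s x
  | ECons x y => Cons (s x) (s y)
  | EHd x => hd (s x)
  | ETl x => tl (s x)
  end.

Definition update (s : store) (x : nat) (v : data) : store :=
  fun y => if y == x then v else s y.

(** [exec c s s' t]: started in [s], the command [c] halts in [s'] at cost [t].
    [Nil] is false, every other value is true.  An assignment is charged the
    size of the value it stores.  Hence the values held by the variables of a
    program have total size at most that of the initial values plus [t]
    (repeating [x := cons x x] does not build exponentially large trees at
    polynomial cost), and a Turing machine simulates a run with polynomial
    overhead; conversely a Turing machine is simulated with polynomial overhead
    by storing each half-tape as a list. *)
Inductive exec : cmd -> store -> store -> nat -> Prop :=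
| ExecSkip s :
    exec Skip s s 1
| ExecAssign s x e :
    exec (Assign x e) s (update s x (eval s e)) (data_size (eval s e)).+1
| ExecSeq c d s s' s'' t t' :
    exec c s s' t -> exec d s' s'' t' ->
    exec (Seq c d) s s'' (t + t').+1
| ExecIfTrue x c d s s' t :
    s x <> Nil -> exec c s s' t -> exec (If x c d) s s' t.+1
| ExecIfFalse x c d s s' t :
    s x = Nil -> exec d s s' t -> exec (If x c d) s s' t.+1
| ExecWhileFalse x c s :
    s x = Nil -> exec (While x c) s s 1
| ExecWhileTrue x c s s' s'' t t' :
    s x <> Nil -> exec c s s' t -> exec (While x c) s' s'' t' ->
    exec (While x c) s s'' (t + t').+1.

Lemma exec_det c s s1 t1 s2 t2 :
  exec c s s1 t1 -> exec c s s2 t2 -> s1 = s2 /\ t1 = t2.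
Proof.
move=> H; elim: H s2 t2 => {c s s1 t1}.
- by move=> s s2 t2 H; inversion H.
- by move=> s x e s2 t2 H; inversion H.
- move=> c d s s' s'' t t' _ IH1 _ IH2 s2 t2 H; inversion H; subst.
  have [? ?] := IH1 _ _ ltac:(eassumption); subst.
  by have [? ?] := IH2 _ _ ltac:(eassumption); subst.
- move=> x c d s s' t nz _ IH s2 t2 H; inversion H; subst=> //.
  by have [? ?] := IH _ _ ltac:(eassumption); subst.
- move=> x c d s s' t z _ IH s2 t2 H; inversion H; subst=> //.
  by have [? ?] := IH _ _ ltac:(eassumption); subst.
- by move=> x c s z s2 t2 H; inversion H; subst.
- move=> x c s s' s'' t t' nz _ IH1 _ IH2 s2 t2 H; inversion H; subst=> //.
  have [? ?] := IH1 _ _ ltac:(eassumption); subst.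
  by have [? ?] := IH2 _ _ ltac:(eassumption); subst.
Qed.

(** The input is placed in variable 0, and so is the output. *)
Definition init (d : data) : store := fun x => if x == 0 then d else Nil.

(** * Encodings *)

Definition enc_bool (b : bool) : data := if b then Cons Nil Nil else Nil.

Definition enc_nat (m : nat) : data := iter m (Cons Nil) Nil.

Definition enc_option (A : Type) (enc : A -> data) (o : option A) : data :=
  if o is Some a then Cons Nil (enc a) else Nil.

Definition enc_seq (A : Type) (enc : A -> data) (l : seq A) : data :=
  foldr (fun a d => Cons (enc a) d) Nil l.

(** * Search problems *)

Record search_problem : Type := SearchProblem {
  input : Type;
  solution : input -> Type;
  input_size : input -> nat;
  enc_input : input -> data;
  enc_solution : forall x : input, solution x -> data;
  is_solution : forall x : input, solution x -> Prop }.

Arguments enc_solution {s x} _.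
Arguments is_solution {s x} _.

(** The answer [None] reports that there is no solution. *)
Definition correct_answer (Q : search_problem) (x : input Q)
    (o : option (solution x)) : Prop :=
  match o with
  | Some y => is_solution y
  | None => forall y : solution x, ~ is_solution y
  end.

(** One program, of polynomially bounded cost, answers every input.  It has a
    unique run on each input by [exec_det]. *)
Definition solvable_in_polynomial_time (Q : search_problem) : Prop :=
  exists (c : cmd) (a k : nat), forall x : input Q,
  exists (o : option (solution x)) (s : store) (t : nat),
    [/\ exec c (init (enc_input x)) s t,
        s 0 = enc_option enc_solution o,
        correct_answer o
      & t <= a * (input_size x).+1 ^ k].

(** * Decision trees

    The finite feature set of a model is ['I_n], with [n] part of the input. *)

Definition example (n : nat) : Type := {ffun 'I_n -> bool}.

(** [Node f t0 t1] has 0-child [t0] and 1-child [t1]. *)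
Inductive dt (n : nat) : Type :=
| Leaf of bool
| Node of 'I_n & dt n & dt n.

Arguments Leaf {n}.

Fixpoint classify (n : nat) (T : dt n) (e : example n) : bool :=
  match T with
  | Leaf b => b
  | Node f t0 t1 => if e f then classify t1 e else classify t0 e
  end.

Fixpoint dt_nodes (n : nat) (T : dt n) : nat :=
  if T is Node _ t0 t1 then (dt_nodes t0 + dt_nodes t1).+1 else 1.

Fixpoint enc_dt (n : nat) (T : dt n) : data :=
  match T with
  | Leaf b => Cons Nil (enc_bool b)
  | Node f t0 t1 =>
      Cons (Cons Nil (enc_nat f)) (Cons (enc_dt t0) (enc_dt t1))
  end.

(** * Explanations *)

Definition lAXp (n : nat) (T : dt n) (e : example n) (A : {set 'I_n}) : Prop :=
  forall e' : example n, {in A, e' =1 e} -> classify T e' = classify T e.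

Definition lCXp (n : nat) (T : dt n) (e : example n) (A : {set 'I_n}) : Prop :=
  exists e' : example n,
    classify T e' <> classify T e /\ forall f, e' f <> e f -> f \in A.

(** A partial assignment maps the features outside its domain to [None]. *)
Definition passign (n : nat) : Type := {ffun 'I_n -> option bool}.

Definition agrees (n : nat) (e : example n) (tau : passign n) : Prop :=
  forall f b, tau f = Some b -> e f = b.

Definition gAXp (n : nat) (T : dt n) (c : bool) (tau : passign n) : Prop :=
  forall e : example n, agrees e tau -> classify T e = c.

Definition gCXp (n : nat) (T : dt n) (c : bool) (tau : passign n) : Prop :=
  forall e : example n, agrees e tau -> classify T e <> c.

Definition set_incl (n : nat) (A B : {set 'I_n}) : Prop := A \subset B.

Definition passign_incl (n : nat) (tau sigma : passign n) : Prop :=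
  forall f b, tau f = Some b -> sigma f = Some b.

Definition inclusion_minimal (E : Type) (incl : E -> E -> Prop)
    (P : E -> Prop) (x : E) : Prop :=
  P x /\ forall y, P y -> incl y x -> y = x.

(** * The four problems

    Sizes are measured as number of features plus number of nodes.  This is at
    most the length of a description listing the features and the nodes, whether features
    are written in unary or in binary, so the unary indices in [enc_dt] do not
    relax the time bound. *)

Record local_input : Type := LocalInput {
  li_n : nat; li_dt : dt li_n; li_example : example li_n }.

Record global_input : Type := GlobalInput {
  gi_n : nat; gi_dt : dt gi_n; gi_class : bool }.

Definition local_size (x : local_input) : nat := li_n x + dt_nodes (li_dt x).

Definition global_size (x : global_input) : nat := gi_n x + dt_nodes (gi_dt x).

Definition enc_example (n : nat) (e : example n) : data :=
  enc_seq enc_bool [seq e f | f <- enum 'I_n].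

(** A set of features is encoded by its characteristic vector. *)
Definition enc_feature_set (n : nat) (A : {set 'I_n}) : data :=
  enc_seq enc_bool [seq f \in A | f <- enum 'I_n].

Definition enc_passign (n : nat) (tau : passign n) : data :=
  enc_seq (enc_option enc_bool) [seq tau f | f <- enum 'I_n].

Definition enc_local_input (x : local_input) : data :=
  Cons (enc_nat (li_n x)) (Cons (enc_dt (li_dt x)) (enc_example (li_example x))).

Definition enc_global_input (x : global_input) : data :=
  Cons (enc_nat (gi_n x)) (Cons (enc_dt (gi_dt x)) (enc_bool (gi_class x))).

Definition local_problem
    (X : forall n, dt n -> example n -> {set 'I_n} -> Prop) : search_problem :=
  {| input := local_input;
     solution := fun x => {set 'I_(li_n x)};
     input_size := local_size;
     enc_input := enc_local_input;
     enc_solution := fun x A => enc_feature_set A;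
     is_solution := fun x A =>
       inclusion_minimal (@set_incl (li_n x)) (X (li_n x) (li_dt x) (li_example x)) A |}.

Definition global_problem
    (X : forall n, dt n -> bool -> passign n -> Prop) : search_problem :=
  {| input := global_input;
     solution := fun x => passign (gi_n x);
     input_size := global_size;
     enc_input := enc_global_input;
     enc_solution := fun x tau => enc_passign tau;
     is_solution := fun x tau =>
       inclusion_minimal (@passign_incl (gi_n x)) (X (gi_n x) (gi_dt x) (gi_class x)) tau |}.

Inductive explanation_type : Type :=
| LocalAbductive | LocalContrastive | GlobalAbductive | GlobalContrastive.

Definition DT_minimal_explanation (P : explanation_type) : search_problem :=
  match P with
  | LocalAbductive => local_problem lAXp
  | LocalContrastive => local_problem lCXp
  | GlobalAbductive => global_problem gAXp
  | GlobalContrastive => global_problem gCXp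
  end.

(* Main.v *)
(** By monotonicity of abductive explanations, a minimal one is found by trying
    to drop the features one after the other; dually, a minimal contrastive
    explanation is found by trying to fix the features to their values in the
    example.  Both are instances of one greedy loop that moves a partial
    assignment towards a target, and both need only a test whether some leaf of a
    given label can be reached under a partial assignment.  The test is a
    depth-first search which records in the assignment the features it branches
    on (a path may test a feature twice), so it visits each node at most once.
    A global abductive explanation exists iff some leaf of the class is
    reachable, and the assignment found there is one to start from; a global
    contrastive explanation is a global abductive one for the other class. *)

Require Import Defs.
From mathcomp Require Import all_boot.
From mathcomp Require Import zify.
(* [seq] has its own [Nil] and [Cons]. *)
Import Defs.

Set Implicit Arguments.
Unset Strict Implicit.
Unset Printing Implicit Defensive.

(** * Monotone polynomial bounds *)

Definition polynomial (B : nat -> nat) : Prop :=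
  {homo B : m n / m <= n} /\ exists a k, forall m, B m <= a * m.+1 ^ k.

Lemma polynomial_const a : polynomial (fun=> a).
Proof. by split=> //; exists a, 0 => m; rewrite muln1. Qed.

Lemma polynomial_id : polynomial id.
Proof. by split=> //; exists 1, 1 => m; rewrite mul1n expn1. Qed.

Lemma polynomialD B C :
  polynomial B -> polynomial C -> polynomial (fun m => B m + C m).
Proof.
move=> [monB [a [k leB]]] [monC [b [l leC]]]; split=> [m n mn|].
  by rewrite leq_add ?monB ?monC.
exists (a + b), (k + l) => m; rewrite mulnDl leq_add //.
  by apply: leq_trans (leB m) _; rewrite leq_mul // leq_pexp2l ?leq_addr.
by apply: leq_trans (leC m) _; rewrite leq_mul // leq_pexp2l ?leq_addl.
Qed.

Lemma polynomialM B C :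
  polynomial B -> polynomial C -> polynomial (fun m => B m * C m).
Proof.
move=> [monB [a [k leB]]] [monC [b [l leC]]]; split=> [m n mn|].
  by rewrite leq_mul ?monB ?monC.
by exists (a * b), (k + l) => m; rewrite expnD mulnACA leq_mul.
Qed.

Lemma polynomial_comp B C :
  polynomial B -> polynomial C -> polynomial (fun m => B (C m)).
Proof.
move=> [monB [a [k leB]]] [monC [b [l leC]]]; split=> [m n mn|].
  by rewrite monB ?monC.
exists (a * b.+1 ^ k), (l * k) => m; apply: leq_trans (leB _) _.
rewrite -mulnA leq_mul // expnM -expnMn.
(* It suffices to compare the bases, since [b * x + 1 <= b.+1 * x] for the positive number
   [x = m.+1 ^ l]; exponent 0 is trivial. *)
case: k {leB} => // k; rewrite leq_exp2r //.
by rewrite mulSn addnC -addn1 leq_add // ?expn_gt0.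
Qed.

Create HintDb ptime.
#[local] Hint Resolve polynomial_const polynomial_id polynomialD polynomialM
  polynomial_comp : ptime.

(** * Polynomial-time functions on trees and their closure properties *)

Lemma data_size_gt0 d : 0 < data_size d.
Proof. by case: d. Qed.

(** The program reads its argument in a register [r] of our choice, leaves the
    result there, and may overwrite the registers above [r] only. *)
Definition ptime (f : data -> data) : Prop :=
  exists (c : nat -> cmd) (B : nat -> nat),
    polynomial B /\ forall r s, exists s' t,
    [/\ exec (c r) s s' t, s' r = f (s r), forall x, x < r -> s' x = s x,
        t <= B (data_size (s r)) & data_size (f (s r)) <= B (data_size (s r))].

Lemma ptime_eq f g : f =1 g -> ptime f -> ptime g.
Proof.
move=> fg [c [B [pB cP]]]; exists c, B; split=> // r s.
by have [s' [t]] := cP r s; rewrite fg; exists s', t.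
Qed.

Lemma updateE s x v : update s x v x = v.
Proof. by rewrite /update eqxx. Qed.

Lemma update_lt s x v y : y < x -> update s x v y = s y.
Proof. by rewrite /update => yx; rewrite ltn_eqF. Qed.

Lemma ptime_assign f (e : nat -> expr) (B : nat -> nat) :
    (forall r s, eval s (e r) = f (s r)) ->
    polynomial B -> (forall d, data_size (f d) <= B (data_size d)) ->
  ptime f.
Proof.
move=> ev pB fB; exists (fun r => Assign r (e r)), (fun m => B m + 1).
split=> [|r s]; first by auto with ptime.
exists (update s r (eval s (e r))), (data_size (eval s (e r))).+1; split.
- exact: ExecAssign.
- by rewrite updateE ev.
- by move=> x xr; rewrite update_lt.
- by rewrite ev addn1 ltnS.
- by rewrite (leq_trans (fB _)) ?leq_addr.
Qed.

Lemma ptime_id : ptime id.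
Proof. exact: (@ptime_assign _ EVar id _ polynomial_id). Qed.

(** The bound on the output size in [ptime] is what controls the argument of the second program. *)
Lemma ptime_comp f g : ptime f -> ptime g -> ptime (fun x => g (f x)).
Proof.
move=> [c [B [pB cP]]] [d [C [pC dP]]].
exists (fun r => Seq (c r) (d r)), (fun m => B m + C (B m) + 1).
split=> [|r s]; first by auto 10 with ptime.
have [s1 [t1 [ex1 r1 lt1 le1 sz1]]] := cP r s.
have [s2 [t2 [ex2 r2 lt2 le2 sz2]]] := dP r s1.
rewrite r1 in r2 le2 sz2.
have := pC.1 _ _ sz1.
exists s2, (t1 + t2).+1; split; [exact: ExecSeq ex1 ex2|by []| |lia|lia].
by move=> x xr; rewrite lt2 ?lt1.
Qed.

Lemma ptime_nil : ptime (fun=> Nil).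
Proof. exact: (@ptime_assign _ (fun=> ENil) _ _ (polynomial_const 1)). Qed.

Lemma ptime_hd f : ptime f -> ptime (fun x => hd (f x)).
Proof.
move=> pf; apply: ptime_comp pf _.
apply: (@ptime_assign _ EHd id _ polynomial_id) => //.
by case=> //= a b; rewrite leqW ?leq_addr.
Qed.

Lemma ptime_tl f : ptime f -> ptime (fun x => tl (f x)).
Proof.
move=> pf; apply: ptime_comp pf _.
apply: (@ptime_assign _ ETl id _ polynomial_id) => //.
by case=> //= a b; rewrite leqW ?leq_addl.
Qed.

Lemma ptime_cons f g :
  ptime f -> ptime g -> ptime (fun x => Cons (f x) (g x)).
Proof.
move=> [c [B [pB cP]]] [d [C [pC dP]]].
(* Both components work on copies: the argument survives in [r] while [f] is computed in [r.+1], and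
   that value survives while [g] is computed in [r.+2]. *)
exists (fun r => Seq (Assign r.+1 (EVar r)) (Seq (c r.+1)
  (Seq (Assign r.+2 (EVar r)) (Seq (d r.+2) (Assign r (ECons r.+1 r.+2)))))).
exists (fun m => 2 * m + 2 * B m + 2 * C m + 10).
split=> [|r s]; first by auto 20 with ptime.
set v := s r.
have [s1 [t1 []]] := cP r.+1 (update s r.+1 v).
rewrite updateE => ex1 r1 lt1 le1 sz1.
have s1r : s1 r = v by rewrite lt1 // update_lt.
have [s2 [t2 []]] := dP r.+2 (update s1 r.+2 v).
rewrite updateE => ex2 r2 lt2 le2 sz2.
have s2r1 : s2 r.+1 = f v by rewrite lt2 // update_lt.
have ex3 := ExecAssign s2 r (ECons r.+1 r.+2).
have ex4 := ExecAssign s1 r.+2 (EVar r); rewrite /= s1r in ex4.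
have ex5 := ExecAssign s r.+1 (EVar r).
have ex := ExecSeq ex5 (ExecSeq ex1 (ExecSeq ex4 (ExecSeq ex2 ex3))).
do 2 eexists; split; first exact: ex.
- by rewrite updateE /= s2r1 r2.
- move=> x xr; have xr1 := ltn_trans xr (ltnSn r).
  by rewrite update_lt // lt2 ?update_lt ?lt1 ?update_lt // ltnW.
- by rewrite /= s2r1 r2 -/v; lia.
- by rewrite /= -/v; lia.
Qed.

Definition ifd (d x y : data) : data := if d is Cons _ _ then x else y.

Lemma ptime_if p f g : ptime p -> ptime f -> ptime g ->
  ptime (fun x => ifd (p x) (f x) (g x)).
Proof.
move=> [cp [Bp [pBp cpP]]] [c [B [pB cP]]] [d [C [pC dP]]].
exists (fun r => Seq (Assign r.+1 (EVar r))
  (Seq (cp r.+1) (If r.+1 (c r) (d r)))).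
exists (fun m => m + Bp m + B m + C m + 10).
split=> [|r s]; first by auto 20 with ptime.
set v := s r.
have [s1 [t1 []]] := cpP r.+1 (update s r.+1 v).
rewrite updateE => ex1 r1 lt1 le1 sz1.
have s1r : s1 r = v by rewrite lt1 // update_lt.
have s1lt x : x < r -> s1 x = s x.
  by move=> xr; have xr1 := ltnW xr; rewrite lt1 ?update_lt.
have ex5 := ExecAssign s r.+1 (EVar r).
rewrite /ifd; case pv: (p v) => [|a b]; rewrite pv in r1.
- have [s2 [t2 []]] := dP r s1; rewrite s1r => ex2 r2 lt2 le2 sz2.
  have ex := ExecSeq ex5 (ExecSeq ex1 (ExecIfFalse (c r) r1 ex2)).
  do 2 eexists; split; [exact: ex|by []| | |].
  + by move=> x xr; rewrite lt2 ?s1lt.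
  + by rewrite /= -/v; lia.
  + by lia.
- have [s2 [t2 []]] := cP r s1; rewrite s1r => ex2 r2 lt2 le2 sz2.
  have nz : s1 r.+1 <> Nil by rewrite r1.
  have ex := ExecSeq ex5 (ExecSeq ex1 (ExecIfTrue (d r) nz ex2)).
  do 2 eexists; split; [exact: ex|by []| | |].
  + by move=> x xr; rewrite lt2 ?s1lt.
  + by rewrite /= -/v; lia.
  + by lia.
Qed.

(** * While loops controlled by a potential *)

(** [Psi] bounds both the number of iterations and the sizes of the iterates. *)
Definition while (Psi : data -> nat) (p f : data -> data) (x : data) : data :=
  iter (Psi x) (fun y => ifd (p y) (f y) y) x.

Section While.

Variables (Psi : data -> nat) (p f : data -> data).
Hypothesis Psi_lt : forall x, p x <> Nil -> Psi (f x) < Psi x.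

Lemma while_nil x : p x = Nil -> while Psi p f x = x.
Proof. by move=> px; apply: iter_fix; rewrite px. Qed.

(** Once the guard is [Nil] the state no longer changes, so every iteration count at least [Psi]
    gives the same result. *)
Lemma while_cons x : p x <> Nil -> while Psi p f x = while Psi p f (f x).
Proof.
rewrite /while; set step := fun y => ifd (p y) (f y) y.
have fixed y m : p y = Nil -> iter m step y = y.
  by move=> py; rewrite iter_fix // /step py.
have stable m k y : Psi y <= m -> Psi y <= k -> iter m step y = iter k step y.
  elim: m k y => [|m IHm] [|k] y ym yk //; have [py|py] :
      p y = Nil \/ p y <> Nil by case: (p y); [left|right].
  - by rewrite !fixed.
  - by have := Psi_lt py; lia.
  - by rewrite !fixed.
  - by have := Psi_lt py; lia.
  - by rewrite !fixed.
  have lt := Psi_lt py; rewrite !iterSr.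
  have -> : step y = f y by rewrite /step; case: (p y) py.
  by apply: IHm; lia.
move=> px; have lt := Psi_lt px; case: (Psi x) lt => // m lt; rewrite iterSr.
have -> : step x = f x by rewrite /step; case: (p x) px.
exact: stable.
Qed.

Lemma while_ind (Q : data -> Prop) :
    (forall x, p x <> Nil -> Q x -> Q (f x)) ->
  forall x, Q x -> Q (while Psi p f x).
Proof.
move=> Qf x Qx; rewrite /while; elim: (Psi x) => //= m.
by case E: (p _) => [|a b] // Qm; apply: Qf => //; rewrite E.
Qed.

(** The decreasing potential allows at most [B] of the initial size many passes. It also dominates
    the size of every iterate, so each pass costs at most a fixed polynomial. *)
Lemma ptime_while B : ptime p -> ptime f -> polynomial B ->
    (forall x, data_size x <= Psi x <= B (data_size x)) ->
  ptime (while Psi p f).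
Proof.
move=> [cp [Bp [pBp cpP]]] [c [C [pC cP]]] pB szB.
pose K M := M + Bp M + C M + 10.
(* The guard value sits in [r.+1], which the body may overwrite, so it is recomputed after each
   pass. *)
exists (fun r =>
  let test := Seq (Assign r.+1 (EVar r)) (cp r.+1) in
  Seq test (While r.+1 (Seq (c r) test))).
exists (fun m => K (B m) * B m + K (B m) + 10).
split=> [|r s /=]; first by rewrite /K; auto 20 with ptime.
set test := Seq _ (cp _).
have testP s0 : exists s' t, [/\ exec test s0 s' t, s' r.+1 = p (s0 r),
    forall x, x <= r -> s' x = s0 x &
    t <= data_size (s0 r) + Bp (data_size (s0 r)) + 2].
  have [s1 [t1 []]] := cpP r.+1 (update s0 r.+1 (s0 r)).
  rewrite updateE => ex1 r1 lt1 le1 _.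
  have ex := ExecSeq (ExecAssign s0 r.+1 (EVar r)) ex1.
  do 2 eexists; split; [exact: ex|by []| |].
    by move=> x xr; rewrite lt1 ?update_lt.
  by rewrite /=; lia.
(* [m] follows the potential down, while [M] stays fixed and bounds the cost of a pass by [K M]. *)
have loopP M m s0 : Psi (s0 r) <= m -> m <= M -> s0 r.+1 = p (s0 r) ->
    exists s' t, [/\ exec (While r.+1 (Seq (c r) test)) s0 s' t,
      s' r = while Psi p f (s0 r), forall x, x < r -> s' x = s0 x &
      t <= K M * m + 1].
  elim: m s0 => [|m IHm] s0 s0m mM s0p; have [py|py] :
      p (s0 r) = Nil \/ p (s0 r) <> Nil by case: (p _); [left|right].
  - exists s0, 1; split=> //; last by lia.
      by apply: ExecWhileFalse; rewrite s0p.
    by rewrite while_nil.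
  - by have := Psi_lt py; lia.
  - exists s0, 1; split=> //; last by lia.
      by apply: ExecWhileFalse; rewrite s0p.
    by rewrite while_nil.
  have lt := Psi_lt py.
  have [s1 [t1 [ex1 r1 lt1 le1 sz1]]] := cP r s0.
  have [s2 [t2 [ex2 r2 lt2 le2]]] := testP s1.
  have s2r : s2 r = f (s0 r) by rewrite lt2.
  have [| | |s3 [t3 [ex3 r3 lt3 le3]]] := IHm s2; rewrite ?s2r; try by lia.
    by rewrite r2 r1.
  have nz : s0 r.+1 <> Nil by rewrite s0p.
  exists s3, ((t1 + t2).+1 + t3).+1; split.
  + exact: ExecWhileTrue nz (ExecSeq ex1 ex2) ex3.
  + by rewrite r3 s2r -while_cons.
  + by move=> x xr; rewrite lt3 // lt2 ?lt1 // ltnW.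
  have /andP[szx _] := szB (s0 r); have /andP[szfx _] := szB (f (s0 r)).
  have := pC.1 _ _ (leq_trans szx (leq_trans s0m mM)).
  have := pBp.1 (data_size (f (s0 r))) M.
  by rewrite r1 in le2; rewrite /K mulnS in le3 *; lia.
have [s1 [t1 [ex1 r1 lt1 le1]]] := testP s.
have s1r : s1 r = s r by rewrite lt1.
have /andP[szs Psis] := szB (s r).
have [| | |s2 [t2 [ex2 r2 lt2 le2]]] :=
  loopP (B (data_size (s r))) (B (data_size (s r))) s1; rewrite ?s1r //.
exists s2, (t1 + t2).+1; split.
- exact: ExecSeq ex1 ex2.
- by rewrite r2 s1r.
- by move=> x xr; rewrite lt2 ?lt1 // ltnW.
- have := pBp.1 _ _ (leq_trans szs Psis).
  by rewrite /K in le2 *; lia.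
have : Psi (while Psi p f (s r)) <= Psi (s r).
  apply: (@while_ind (fun y => Psi y <= Psi (s r))) => // x px.
  by have := Psi_lt px; lia.
have /andP[sz _] := szB (while Psi p f (s r)); rewrite /K.
by lia.
Qed.

End While.

(** * Traversal of a list with an accumulator *)

Lemma data_sizeE d :
  [/\ data_size (hd d) <= data_size d, data_size (tl d) <= data_size d &
      data_size d <= data_size (hd d) + data_size (tl d) + 1].
Proof. by case: d => //= a b; split; lia. Qed.

(** [g] sees the whole remaining list, so that in [enc_nat] its length can serve
    as a counter. *)
Fixpoint loop (g : data -> data -> data -> data) (env acc l : data) : data :=
  if l is Cons _ l' then loop g env (g env acc l) l' else acc.

(** Growth of the accumulator is only additive in each pass, which excludes repeated doubling. *)
Lemma ptime_loop g C :
    ptime (fun x => g (hd x) (hd (tl x)) (tl (tl x))) ->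
    (forall env acc l, data_size (g env acc l) <=
       data_size acc + C * (data_size env + data_size l)) ->
  forall e a l, ptime e -> ptime a -> ptime l ->
    ptime (fun x => loop g (e x) (a x) (l x)).
Proof.
move=> pg szg e a l pe pa pl.
pose f x := Cons (hd x)
  (Cons (g (hd x) (hd (tl x)) (tl (tl x))) (tl (tl (tl x)))).
(* The first summands bound the size of the state; the product pays in advance for all later growth
   of the accumulator. *)
pose Psi x :=
  let E := data_size (hd x) in let A := data_size (hd (tl x)) in
  let L := data_size (tl (tl x)) in E + A + L + 2 + L * (C * (E + L)).
have Psi_lt x : tl (tl x) <> Nil -> Psi (f x) < Psi x.
  case: x => [|env [|acc [|d l']]] //= _; rewrite /Psi /=.
  have /= := szg env acc (Cons d l').
  have := data_size_gt0 d; move: (data_size (g _ _ _)).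
  move: (data_size d) (data_size l') (data_size env) (data_size acc).
  move=> D L E A G d0 leG.
  have : L * (C * (E + L)) <= (D + L) * (C * (E + (D + L).+1)).
    by rewrite !leq_mul //; lia.
  by rewrite mulSn; lia.
pose B m := m + m + m + 2 + m * (C * (m + m)).
have pB : polynomial B by rewrite /B; auto 20 with ptime.
have pw : ptime (while Psi (fun x => tl (tl x)) f).
  apply: ptime_while Psi_lt _ _ _ pB _.
  - exact/ptime_tl/ptime_tl/ptime_id.
  - by do ?[apply: ptime_cons | apply: pg | exact: ptime_id |
            apply: ptime_hd | apply: ptime_tl].
  move=> x; have sz y := data_sizeE y.
  have [h1 l1 u1] := sz x; have [h2 l2 u2] := sz (tl x).
  rewrite /Psi /B; apply/andP; split; first by lia.
  by rewrite !leq_add ?leq_mul //; lia.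
have pc := ptime_comp (ptime_cons pe (ptime_cons pa pl)) pw.
apply: ptime_eq (ptime_hd (ptime_tl pc)) => x.
elim: (l x) (a x) => [|d _ l' IHl] acc; first by rewrite while_nil.
by rewrite (while_cons Psi_lt) //= IHl.
Qed.

Ltac ptime_step := first
  [ assumption | exact: ptime_id | apply: ptime_cons | apply: ptime_if
  | apply: ptime_hd | apply: ptime_tl | exact: ptime_nil ].

(** * Booleans and list operations on trees *)

Definition trued : data := Cons Nil Nil.
Definition notd (b : data) : data := ifd b Nil trued.
(** Equality of truth values, not of trees: any tree other than [Nil] counts as true. *)
Definition eqd (b c : data) : data := ifd b c (notd c).

Fixpoint dropd (f l : data) : data :=
  if f is Cons _ f' then dropd f' (tl l) else l.

Definition lookup (l f : data) : data := hd (dropd f l).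

Fixpoint setd (l f v : data) : data :=
  if f is Cons _ f' then Cons (hd l) (setd (tl l) f' v) else Cons v (tl l).

Fixpoint catrevd (l acc : data) : data :=
  if l is Cons d l' then catrevd l' (Cons d acc) else acc.

Fixpoint mapd (g : data -> data) (l : data) : data :=
  if l is Cons d l' then Cons (g d) (mapd g l') else Nil.

Lemma ptime_not b : ptime b -> ptime (fun x => notd (b x)).
Proof. by move=> pb; do ?ptime_step. Qed.

Lemma ptime_eqd b c : ptime b -> ptime c -> ptime (fun x => eqd (b x) (c x)).
Proof. by move=> pb pc; do ?ptime_step. Qed.

Lemma ptime_drop f l : ptime f -> ptime l -> ptime (fun x => dropd (f x) (l x)).
Proof.
move=> pf pl.
apply: (@ptime_eq (fun x => loop (fun _ a _ => tl a) Nil (l x) (f x))).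
  by move=> x; elim: (f x) (l x) => //= _ _ f' IH l'; rewrite IH.
apply: (ptime_loop (C := 0)) => //; do ?ptime_step.
by move=> env a l0; have [] := data_sizeE a; lia.
Qed.

Lemma ptime_lookup l f :
  ptime l -> ptime f -> ptime (fun x => lookup (l x) (f x)).
Proof. by move=> pl pf; apply/ptime_hd/ptime_drop. Qed.

Lemma ptime_catrev l a :
  ptime l -> ptime a -> ptime (fun x => catrevd (l x) (a x)).
Proof.
move=> pl pa.
apply: (@ptime_eq (fun x => loop (fun _ a l => Cons (hd l) a) Nil (a x) (l x))).
  by move=> x; elim: (l x) (a x) => //= d _ l' IH acc; rewrite IH.
apply: (ptime_loop (C := 2)) => //; do ?ptime_step.
move=> env acc l0 /=; have [] := data_sizeE l0; have := data_size_gt0 l0; lia.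
Qed.

Lemma ptime_set l f v :
  ptime l -> ptime f -> ptime v -> ptime (fun x => setd (l x) (f x) (v x)).
Proof.
move=> pl pf pv.
(* A zipper: move [f] entries to the reversed prefix, and back. *)
pose move_right (_ a _ : data) := Cons (Cons (hd (tl a)) (hd a)) (tl (tl a)).
pose zip l f := loop move_right Nil (Cons Nil l) f.
have pz : ptime (fun x => zip (l x) (f x)).
  apply: (ptime_loop (C := 2)) => //; do ?ptime_step.
  move=> env a f0 /=; have [] := data_sizeE a; have [] := data_sizeE (tl a).
  have := data_size_gt0 f0; have := data_size_gt0 env.
  case: a => [|a b] /=; first by lia.
  by case: b => /=; lia.
pose F x := let z := zip (l x) (f x) in catrevd (hd z) (Cons (v x) (tl (tl z))).
apply: (@ptime_eq F) => [x|].
  rewrite /F /zip.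
  suff zipP p s : let z := loop move_right Nil (Cons p s) (f x) in
      catrevd (hd z) (Cons (v x) (tl (tl z))) = catrevd p (setd s (f x) (v x)).
    exact: zipP.
  by elim: (f x) p s => //= d _ f' IH p s; rewrite IH.
by apply: ptime_catrev; do ?ptime_step.
Qed.

(** A position past the end of [l] makes [setd] pad with [Nil]; the last summand pays for this. *)
Lemma size_setd l f v :
  data_size (setd l f v) <= data_size l + data_size v + 2 * data_size f.
Proof.
elim: f l => [|d _ f' IH] l /=.
  by case: l => [|a l] /=; lia.
by have := IH (tl l); have := data_size_gt0 d; case: l => [|a l] /=; lia.
Qed.

Lemma ptime_map g C :
    ptime g -> (forall d, data_size (g d) <= data_size d + C) ->
  forall l, ptime l -> ptime (fun x => mapd g (l x)).
Proof.
move=> pg szg l pl.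
(* The loop produces the image in reverse order, and [catrevd] turns it round. *)
pose F x := catrevd (loop (fun _ a l => Cons (g (hd l)) a) Nil Nil (l x)) Nil.
apply: (@ptime_eq F) => [x|].
  suff mapP acc : catrevd (loop (fun _ a l => Cons (g (hd l)) a) Nil acc (l x)) Nil
      = catrevd acc (mapd g (l x)) by exact: mapP.
  by elim: (l x) acc => //= d _ l' IH acc; rewrite IH.
apply: ptime_catrev; last exact: ptime_nil.
apply: (ptime_loop (C := C + 2)) => //; do ?ptime_step.
  exact: ptime_comp (ptime_hd (ptime_tl (ptime_tl ptime_id))) pg.
move=> env acc l0 /=; have [hdl _ _] := data_sizeE l0; have := szg (hd l0).
by have := data_size_gt0 l0; nia.
Qed.

(** * Depth-first search for a leaf *)

(** The stack holds pairs of a subtree and a partial assignment.  Expanding a node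
    [f] copies the assignment and enlarges the copies by [O(data_size f)], hence
    the products: the factors of the two subtrees add up to less than that of the
    node, and [f] is paid for by the second summand. *)
Fixpoint weight (stack : data) : nat :=
  if stack is Cons j r then
    data_size (hd j) * (data_size (tl j) + 3 * data_size (hd j)) + weight r
  else 0.

(** The weight term bounds the size of the stack and also pays for the assignment that a leaf copies
    into the result. *)
Definition dfs_potential (x : data) : nat :=
  data_size (hd x) + data_size (hd (tl x)) + 3 + 3 * weight (tl (tl x)).

(** The state consists of the wanted label, the result so far and the stack. The 0-child goes on top
    of the 1-child, and a later leaf overwrites the result. *)
Definition dfs_step (x : data) : data :=
  let b := hd x in
  let res := hd (tl x) in
  let stack := tl (tl x) in
  let T := hd (hd stack) in
  let tau := tl (hd stack) in
  let f := tl (hd T) in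
  let v := lookup tau f in
  Cons b
    (ifd (hd T)
       (Cons res
          (ifd v
            (Cons (Cons (ifd (tl v) (tl (tl T)) (hd (tl T))) tau) (tl stack))
            (Cons (Cons (hd (tl T)) (setd tau f (Cons Nil Nil)))
            (Cons (Cons (tl (tl T)) (setd tau f (Cons Nil trued))) (tl stack)))))
       (Cons (ifd (eqd (tl T) b) (Cons Nil tau) res) (tl stack))).

(** The decrease is needed on all trees, not only on encodings, because [ptime] quantifies over
    every input. *)
Lemma dfs_potential_lt x :
  tl (tl x) <> Nil -> dfs_potential (dfs_step x) < dfs_potential x.
Proof.
case: x => [|b [|res [|j stack]]] // _.
rewrite /dfs_potential /dfs_step /=; set T := hd j; set tau := tl j.
have tau0 := data_size_gt0 tau.
have leaf c : data_size (ifd c (Cons Nil tau) res) < data_size res + data_size tau + 3.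
  by case: c => [|? ?] /=; have := data_size_gt0 res; lia.
case: T => [|[|h f] T] /=.
- by have := leaf (notd b); lia.
- by have := leaf (eqd T b); have := data_size_gt0 T; nia.
have h0 := data_size_gt0 h.
have szT : data_size (hd T) + data_size (tl T) <= data_size T + 1.
  by case: T => //= t0 t1; lia.
have := data_size_gt0 (hd T); have := data_size_gt0 (tl T).
have child t0 : t0 <= data_size T -> t0 * (data_size tau + 3 * t0) <
    (data_size h + data_size f + data_size T).+2 *
      (data_size tau + 3 * (data_size h + data_size f + data_size T).+2).
  by move=> le; nia.
case: (lookup tau f) => [|d v] /= t1_gt0 t0_gt0.
  have := size_setd tau f (Cons Nil Nil); have := size_setd tau f (Cons Nil trued).
  rewrite /=; move: (data_size (setd _ _ _)) (data_size (setd _ _ _)).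
  move: (data_size tau) (data_size (hd T)) (data_size (tl T)) (data_size T)
    (data_size f) (data_size h) h0 szT t0_gt0 t1_gt0 tau0.
  move=> t a c m n k k0 acm a0 c0 t_gt0 s0 s1 les0 les1.
  (* [m'] is the size of the node and [M] bounds the second factors of both children. As
     [(a + c).+1 <= m'], at least one positive [M] is left over. *)
  set m' := (k + n + m).+2; set M := t + 3 * m'.
  have lea : a * (s0 + 3 * a) <= a * M by rewrite leq_mul // /M /m'; lia.
  have lec : c * (s1 + 3 * c) <= c * M by rewrite leq_mul // /M /m'; lia.
  have : (a + c).+1 * M <= m' * M by rewrite leq_mul // /m'; lia.
  have M_gt0 : 0 < M by rewrite /M; lia.
  rewrite mulSn mulnDl; move: lea lec M_gt0.
  by move=> *; lia.
by have [] := (child (data_size (hd T)), child (data_size (tl T)));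
  case: v => [|? ?] /=; lia.
Qed.

Lemma ptime_dfs_while : ptime (while dfs_potential (fun x => tl (tl x)) dfs_step).
Proof.
have weight_le s : weight s <= 4 * (data_size s * data_size s).
  elim: s => //= j _ r IH; have [] := data_sizeE j.
  by move: (data_size (hd j)) (data_size (tl j)) => a b la lb _; nia.
pose B m := m + m + 3 + 3 * (4 * (m * m)).
have pB : polynomial B by rewrite /B; auto 20 with ptime.
apply: ptime_while dfs_potential_lt _ _ _ pB _.
- by do !ptime_step.
- rewrite /dfs_step; cbv zeta.
  by do ?[apply: ptime_lookup | apply: ptime_set | apply: ptime_eqd | ptime_step].
move=> x; rewrite /dfs_potential /B.
have [h1 l1 u1] := data_sizeE x; have [h2 l2 u2] := data_sizeE (tl x).
have size_le s : data_size s <= 1 + 3 * weight s.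
  elim: s => //= j _ r IH; have := data_size_gt0 (tl j).
  have := data_size_gt0 (hd j); have [_ _] := data_sizeE j.
  by move: (data_size (hd j)) (data_size (tl j)) => a b *; nia.
have := size_le (tl (tl x)); have := weight_le (tl (tl x)) => le1 le2.
have : data_size (tl (tl x)) * data_size (tl (tl x)) <= data_size x * data_size x.
  by rewrite leq_mul //; lia.
by lia.
Qed.

Definition dfs_run (b res stack : data) : data :=
  hd (tl (while dfs_potential (fun x => tl (tl x)) dfs_step
            (Cons b (Cons res stack)))).

Definition dfsd (T b tau : data) : data :=
  dfs_run b Nil (Cons (Cons T tau) Nil).

Lemma ptime_dfs T b tau : ptime T -> ptime b -> ptime tau ->
  ptime (fun x => dfsd (T x) (b x) (tau x)).
Proof.
move=> pT pb ptau; rewrite /dfsd /dfs_run; do 2 ptime_step.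
by apply: ptime_comp ptime_dfs_while; do ?ptime_step.
Qed.

(** * The greedy loop *)

(** [want] tells whether the leaves labelled [b] shall stay reachable
    (contrastive) or unreachable (abductive).  The feature tried is the length of
    [tl rest], that is, the features are tried in decreasing order. *)
Definition greedy_step (env sigma rest : data) : data :=
  let f := tl rest in
  let T := hd (hd env) in
  let b := tl (hd env) in
  let want := hd (tl env) in
  let target := tl (tl env) in
  let sigma' := setd sigma f (lookup target f) in
  ifd (eqd (dfsd T b sigma') want) sigma' sigma.

Definition greedy (T b want target sigma l : data) : data :=
  loop greedy_step (Cons (Cons T b) (Cons want target)) sigma l.

Lemma size_lookup l f : data_size (lookup l f) <= data_size l.
Proof.
rewrite /lookup; elim: f l => [|d _ f' IH] l /=; first by have [] := data_sizeE l.
by have [_] := data_sizeE l; have := IH (tl l); lia.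
Qed.

Lemma ptime_greedy T b want target sigma l :
    ptime T -> ptime b -> ptime want -> ptime target -> ptime sigma ->
    ptime l ->
  ptime (fun x => greedy (T x) (b x) (want x) (target x) (sigma x) (l x)).
Proof.
(* A pass adds at most the size of a target entry, which lies in the environment, plus twice that of
   the counter. *)
move=> *; rewrite /greedy; apply: (ptime_loop (C := 2)) => //.
- rewrite /greedy_step; cbv zeta.
  by do ?[apply: ptime_dfs | apply: ptime_lookup | apply: ptime_set
         | apply: ptime_eqd | ptime_step].
- move=> env s rest; rewrite /greedy_step; set f := tl rest.
  set v := lookup _ _.
  have := size_setd s f v; have := size_lookup (tl (tl env)) f; rewrite -/v.
  have : data_size f <= data_size rest by have [] := data_sizeE rest.
  have := data_sizeE env; have := data_sizeE (tl env).
  by move=> [_ ? _] [_ ? _]; case: (eqd _ _) => /=; lia.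
- by do !ptime_step.
Qed.

(** * List operations on encoded data *)

Section Encodings.

Variables (A : Type) (enc : A -> data).

Lemma lookup_seq x0 (s : seq A) i :
  i < size s -> lookup (enc_seq enc s) (enc_nat i) = enc (nth x0 s i).
Proof. by rewrite /lookup; elim: i s => [|i IH] [|x s] //= /IH. Qed.

Lemma setd_seq x0 (s : seq A) i v : i < size s ->
  setd (enc_seq enc s) (enc_nat i) (enc v) = enc_seq enc (set_nth x0 s i v).
Proof. by elim: i s => [|i IH] [|x s] //= /IH <-. Qed.

Lemma mapd_seq (B : Type) (enc' : B -> data) g h (s : seq A) :
    (forall x, g (enc x) = enc' (h x)) ->
  mapd g (enc_seq enc s) = enc_seq enc' (map h s).
Proof. by move=> gh; elim: s => //= x s ->; rewrite gh. Qed.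

End Encodings.

Lemma eqd_bool b c : eqd (enc_bool b) (enc_bool c) = enc_bool (b == c).
Proof. by case: b c => [] []. Qed.

Lemma eqd_option (A : Type) (enc : A -> data) o b :
  eqd (enc_option enc o) (enc_bool b) = enc_bool (isSome o == b).
Proof. by case: o b => [a|] []. Qed.

Lemma notd_bool b : notd (enc_bool b) = enc_bool (~~ b).
Proof. by case: b. Qed.

Lemma ifd_bool b x y : ifd (enc_bool b) x y = if b then x else y.
Proof. by case: b. Qed.

(** * Partial assignments and their encodings *)

Section PartialAssignments.

Variable n : nat.
Implicit Types (tau : passign n) (f : 'I_n) (v : option bool) (e : example n).

Definition setp tau f v : passign n := [ffun g => if g == f then v else tau g].

Definition of_example e : passign n := [ffun f => Some (e f)].

Definition nowhere : passign n := [ffun=> None].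

Lemma setpE tau f v g : setp tau f v g = if g == f then v else tau g.
Proof. exact: ffunE. Qed.

Lemma of_exampleE e f : of_example e f = Some (e f).
Proof. exact: ffunE. Qed.

Lemma nowhereE f : nowhere f = None.
Proof. exact: ffunE. Qed.

Lemma size_passign (A : Type) (g : 'I_n -> A) :
  size [seq g f | f <- enum 'I_n] = n.
Proof. by rewrite size_map size_enum_ord. Qed.

Lemma nth_passign (A : Type) x0 (g : 'I_n -> A) f :
  nth x0 [seq g f | f <- enum 'I_n] f = g f.
Proof.
have lt_f : f < size (enum 'I_n) by rewrite size_enum_ord.
by have := nth_map f x0 g lt_f; rewrite nth_ord_enum.
Qed.

Lemma lookup_passign tau f :
  lookup (enc_passign tau) (enc_nat f) = enc_option enc_bool (tau f).
Proof.
by rewrite /enc_passign (lookup_seq _ None) ?size_passign ?nth_passign.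
Qed.

Lemma setd_passign tau f v :
  setd (enc_passign tau) (enc_nat f) (enc_option enc_bool v)
  = enc_passign (setp tau f v).
Proof.
rewrite /enc_passign (setd_seq _ None) ?size_passign //.
congr enc_seq; apply: (@eq_from_nth _ None) => [|i].
  by rewrite size_set_nth !size_passign; apply/maxn_idPr.
rewrite size_set_nth size_passign (maxn_idPr _) // => lt_in.
rewrite nth_set_nth -[i]/(val (Ordinal lt_in)).
rewrite [RHS](nth_passign None (setp tau f v) (Ordinal lt_in)) setpE.
by rewrite -(nth_passign None tau (Ordinal lt_in)).
Qed.

Lemma enc_of_example e :
  mapd (Cons Nil) (enc_example e) = enc_passign (of_example e).
Proof.
rewrite /enc_example /enc_passign.
rewrite (mapd_seq (enc' := enc_option enc_bool) (h := Some)) // -map_comp.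
by congr enc_seq; apply: eq_map => f; rewrite /= of_exampleE.
Qed.

(** A unary number is a list of [Nil], and [Nil] encodes [None]; the programs therefore use [n] both
    as counter and as empty assignment. *)
Lemma enc_nowhere : enc_nat n = enc_passign nowhere.
Proof.
rewrite /enc_passign -[in LHS](size_enum_ord n).
by elim: (enum _) => //= f s <-; rewrite nowhereE.
Qed.

Lemma enc_feature_set_map (g : data -> data) (h : option bool -> bool) tau :
    (forall v, g (enc_option enc_bool v) = enc_bool (h v)) ->
  mapd g (enc_passign tau) = enc_feature_set [set f | h (tau f)].
Proof.
move=> gh; rewrite /enc_passign /enc_feature_set (mapd_seq _ gh) -map_comp.
by congr enc_seq; apply: eq_map => f; rewrite /= inE.
Qed.

Lemma agrees_incl e tau sigma :
  passign_incl tau sigma -> agrees e sigma -> agrees e tau.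
Proof. by move=> incl agr f b /incl/agr. Qed.

Lemma agrees_ex tau : exists e, agrees e tau.
Proof. by exists [ffun f => odflt false (tau f)] => f b; rewrite ffunE => ->. Qed.

Lemma agrees_of_example e e' : agrees e' (of_example e) <-> e' = e.
Proof.
split=> [agr|-> f b]; last by rewrite of_exampleE => -[].
by apply/ffunP => f; apply: agr; rewrite of_exampleE.
Qed.

Lemma agrees_nowhere e : agrees e nowhere.
Proof. by move=> f b; rewrite nowhereE. Qed.

(** * Recursive form of the search and its correctness *)

(** The 1-child takes precedence because the stack search visits it last and keeps the last leaf
    found. *)
Fixpoint dt_find (b : bool) (T : dt n) tau : option (passign n) :=
  match T with
  | Leaf c => if c == b then Some tau else None
  | Node f t0 t1 =>
      match tau f with
      | Some v => if v then dt_find b t1 tau else dt_find b t0 tau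
      | None =>
          let r := dt_find b t0 (setp tau f (Some false)) in
          if dt_find b t1 (setp tau f (Some true)) is Some s then Some s else r
      end
  end.

Lemma dfs_runE b res j stack : dfs_run b res (Cons j stack) =
  hd (tl (while dfs_potential (fun x => tl (tl x)) dfs_step
            (dfs_step (Cons b (Cons res (Cons j stack)))))).
Proof. by rewrite /dfs_run (while_cons dfs_potential_lt). Qed.

(** The top item is processed completely before the rest of the stack is touched; arbitrary [res]
    and [stack] make the induction on [T] go through. *)
Lemma dfs_run_find b T tau res stack :
  dfs_run (enc_bool b) res (Cons (Cons (enc_dt T) (enc_passign tau)) stack)
  = dfs_run (enc_bool b)
      (if dt_find b T tau is Some s then Cons Nil (enc_passign s) else res) stack.
Proof.
elim: T tau res stack => [c|f t0 IH0 t1 IH1] tau res stack.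
  rewrite dfs_runE -[dfs_step _]/(Cons (enc_bool b) (Cons
    (ifd (eqd (enc_bool c) (enc_bool b)) (Cons Nil (enc_passign tau)) res) stack)).
  by rewrite eqd_bool ifd_bool /=; case: eqP.
rewrite dfs_runE /dfs_step /= lookup_passign.
case: (tau f) => [v|] /=.
  by rewrite ifd_bool; case: v; [exact: IH1|exact: IH0].
rewrite (setd_passign tau f (Some true)) (setd_passign tau f (Some false)).
by have := IH0; rewrite /dfs_run => ->; have := IH1; rewrite /dfs_run => ->;
  case: dt_find.
Qed.

Lemma dfs_find b T tau :
  dfsd (enc_dt T) (enc_bool b) (enc_passign tau)
  = enc_option (@enc_passign n) (dt_find b T tau).
Proof. by rewrite /dfsd dfs_run_find /dfs_run while_nil. Qed.

(** The returned assignment fixes every feature on the path, so all examples agreeing with it end in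
    the same leaf. *)
Lemma dt_find_Some b T tau s : dt_find b T tau = Some s ->
  passign_incl tau s /\ forall e, agrees e s -> classify T e = b.
Proof.
elim: T tau => [c|f t0 IH0 t1 IH1] tau /=.
  by case: eqP => // -> [<-]; split.
case tauf: (tau f) => [v|].
  have branch t : (forall tau, dt_find b t tau = Some s ->
      passign_incl tau s /\ forall e, agrees e s -> classify t e = b) ->
    dt_find b t tau = Some s -> passign_incl tau s /\
      forall e, agrees e s -> e f = v /\ classify t e = b.
    move=> IH /IH[incl cl]; split=> // e agr; split; last exact: cl.
    by apply: agr; apply: incl.
  by case: v tauf branch => tauf branch /branch[] // incl cl; split=> // e;
    move=> /cl[-> ->].
have branch c t : (forall tau, dt_find b t tau = Some s ->
    passign_incl tau s /\ forall e, agrees e s -> classify t e = b) ->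
  dt_find b t (setp tau f (Some c)) = Some s -> passign_incl tau s /\
    forall e, agrees e s -> e f = c /\ classify t e = b.
  move=> IH /IH[incl cl]; split=> [g d taug|e agr].
    by apply: incl; rewrite setpE; case: eqP taug => // ->; rewrite tauf.
  by split; [apply/agr/incl; rewrite setpE eqxx | apply: cl].
case E: (dt_find b t1 _) => [s'|].
  move=> [ss']; move: E; rewrite ss' => /branch[] // incl cl.
  by split=> // e /cl[-> ->].
by move=> /branch[] // incl cl; split=> // e /cl[-> ->].
Qed.

Lemma dt_find_None b T tau e :
  dt_find b T tau = None -> agrees e tau -> classify T e <> b.
Proof.
elim: T tau => [c|f t0 IH0 t1 IH1] tau /=; first by case: eqP.
case tauf: (tau f) => [v|] /=.
  move=> fd agr; rewrite (agr _ _ tauf).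
  by case: v {tauf} fd => [/IH1|/IH0]; exact.
case E: (dt_find b t1 _) => // E0 agr.
(* Follow the branch that [e] itself takes at [f]. *)
have agr' : agrees e (setp tau f (Some (e f))).
  by move=> g c; rewrite setpE; case: eqP => [-> [] //|_ /agr].
by case ef: (e f) agr' => [] agr'; [apply: IH1 E agr'|apply: IH0 E0 agr'].
Qed.

Definition reachable (b : bool) (T : dt n) tau : Prop :=
  exists2 e, agrees e tau & classify T e = b.

Lemma dt_findP b T tau : reflect (reachable b T tau) (dt_find b T tau).
Proof.
case E: (dt_find b T tau) => [s|]; constructor.
  have [incl cl] := dt_find_Some E; have [e agr] := agrees_ex s.
  by exists e; [apply: agrees_incl agr|apply: cl].
by move=> [e /(dt_find_None E)].
Qed.

(** Under a total assignment the search just evaluates the tree, so it serves to compute the class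
    of an example. *)
Lemma dt_find_of_example b T e :
  dt_find b T (of_example e) = (classify T e == b) :> bool.
Proof.
apply/dt_findP/eqP => [[e' /agrees_of_example ->] //|cl].
by exists e => //; apply/agrees_of_example.
Qed.

(** * Correctness of the greedy loop *)

Section Greedy.

Variables (b want : bool) (T : dt n) (target sigma0 : passign n).

Let Q tau := dt_find b T tau == want :> bool.

Definition between tau := forall f, tau f = target f \/ tau f = sigma0 f.

(** Moving entries to the target can destroy [Q] but not restore it, so a rejected move stays
    rejected. *)
Hypothesis Q_anti : forall tau tau', between tau ->
  (forall f, tau' f = tau f \/ tau' f = target f) -> Q tau' -> Q tau.

Lemma greedyP : Q sigma0 -> exists tau,
  [/\ greedy (enc_dt T) (enc_bool b) (enc_bool want) (enc_passign target)
        (enc_passign sigma0) (enc_nat n) = enc_passign tau,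
      Q tau, between tau &
      forall f, Q (setp tau f (target f)) -> tau f = target f].
Proof.
move=> Q0; have btw0 : between sigma0 by right.
have done0 f : n <= f -> Q (setp sigma0 f (target f)) -> sigma0 f = target f.
  by rewrite leqNgt ltn_ord.
rewrite /greedy; set env := Cons _ _.
(* Invariant: the features from [m] upwards are settled. It holds vacuously at [m = n]. *)
suff loopP m tau : m <= n -> Q tau -> between tau ->
    (forall f, m <= f -> Q (setp tau f (target f)) -> tau f = target f) ->
  exists tau', [/\ loop greedy_step env (enc_passign tau) (enc_nat m)
      = enc_passign tau', Q tau', between tau' &
      forall f, Q (setp tau' f (target f)) -> tau' f = target f].
  exact: (loopP n sigma0).
elim: m tau => [|m IHm] tau le_mn Qtau btw dn.
  by exists tau; split=> // f; apply: dn.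
pose f := Ordinal le_mn; pose tau' := setp tau f (target f).
have btw' g v : v = target g -> between (setp tau g v).
  by move=> -> h; rewrite setpE; case: eqP => [->|_]; [left|exact: btw].
have -> : loop greedy_step env (enc_passign tau) (enc_nat m.+1)
    = loop greedy_step env (enc_passign (if Q tau' then tau' else tau))
        (enc_nat m).
  rewrite /= {2}/greedy_step /= -[enc_nat m]/(enc_nat f) lookup_passign.
  by rewrite setd_passign dfs_find eqd_option ifd_bool -/tau' -/(Q tau'); case: ifP.
case: ifPn => Qtau'; apply: (IHm _ (ltnW le_mn)) => //; first exact: btw'.
- move=> g mg Qg; rewrite setpE; case: eqP => [-> //|/eqP gf].
  apply: dn; first by rewrite ltn_neqAle mg andbT eq_sym.
  (* If moving [g] succeeds after [f] was moved, it would have succeeded before. *)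
  apply: Q_anti Qg; first exact: btw'.
  by move=> h; rewrite !setpE; case: eqP => [->|_]; [left|case: eqP => [->|]; auto].
- move=> g; rewrite leq_eqVlt => /orP[/eqP mg|mg]; last exact: dn.
  have -> : g = f by apply: val_inj.
  by move=> Qf; rewrite Qf in Qtau'.
Qed.

End Greedy.

End PartialAssignments.

(** * Explanations obtained from the greedy loop *)

Section Explanations.

Variables (n : nat) (T : dt n).
Implicit Types (tau : passign n) (e : example n).

Lemma gAXpE c tau : gAXp T c tau <-> ~~ dt_find (~~ c) T tau.
Proof.
split=> [ax|/dt_findP nr e agr].
  by apply/dt_findP => -[e /ax ->]; case: c {ax}.
apply/eqP/negPn/negP => /eqP ne; apply: nr; exists e => //.
by case: (classify T e) c ne => [] [].
Qed.

Lemma gCXpE c tau : gCXp T c tau <-> gAXp T (~~ c) tau.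
Proof.
split=> X e /X; first by case: (classify T e) c {X} => [] [].
by move=> ->; case: c {X}.
Qed.

Lemma gAXp_incl c tau sigma :
  passign_incl tau sigma -> gAXp T c tau -> gAXp T c sigma.
Proof. by move=> incl ax e /(agrees_incl incl)/ax. Qed.

Lemma greedy_gAXp c sigma : gAXp T c sigma -> exists tau,
  [/\ greedy (enc_dt T) (enc_bool (~~ c)) (enc_bool false)
        (enc_passign (nowhere n)) (enc_passign sigma) (enc_nat n)
      = enc_passign tau,
      passign_incl tau sigma &
      inclusion_minimal (@passign_incl n) (gAXp T c) tau].
Proof.
move=> ax_sigma.
have [||tau [-> Qtau btw maxi]] :=
    @greedyP n (~~ c) false T (nowhere n) sigma.
- move=> tau tau' _ incl; rewrite !eqbF_neg => /gAXpE ax.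
  by apply/gAXpE; apply: gAXp_incl ax => f v; case: (incl f) => ->; rewrite ?nowhereE.
- by rewrite eqbF_neg; apply/gAXpE.
exists tau; split=> //.
  by move=> f v; case: (btw f) => -> //; rewrite nowhereE.
split=> [|rho ax_rho incl]; first by apply/gAXpE; rewrite -eqbF_neg.
apply/ffunP => f; case rhof: (rho f) => [v|]; first by rewrite (incl _ _ rhof).
rewrite maxi ?nowhereE // eqbF_neg; apply/gAXpE; apply: gAXp_incl ax_rho => g v.
by rewrite setpE; case: eqP => [->|_ /incl //]; rewrite rhof.
Qed.

(** Restricting [e] identifies feature sets with assignments included in [of_example e]. As a
    boolean, [tau f] tests definedness, so the set is the domain of [tau]. *)
Lemma lAXp_of_gAXp e tau : passign_incl tau (of_example e) ->
    inclusion_minimal (@passign_incl n) (gAXp T (classify T e)) tau ->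
  inclusion_minimal (@set_incl n) (lAXp T e) [set f | tau f].
Proof.
move=> incl [ax min]; split=> [e' agr|B lax /subsetP BA].
  apply: ax => f v tauf; rewrite agr ?inE ?tauf //.
  by have := incl _ _ tauf; rewrite of_exampleE => -[].
pose rho : passign n := [ffun f => if f \in B then Some (e f) else None].
have -> : tau = rho.
  apply/esym/min => [e' agr|f v].
    by apply: lax => f fB; apply: agr; rewrite ffunE fB.
  rewrite ffunE; case: ifP => // /BA; rewrite inE => tauf [<-].
  case E: (tau f) tauf => [w|] // _.
  by have := incl _ _ E; rewrite of_exampleE => -[->].
by apply/setP => f; rewrite inE ffunE; case: ifP.
Qed.

(** The undefined features are those allowed to change: they form a contrastive explanation when a
    leaf of the other class is reachable. Fixing as many features as possible makes this set
    minimal. *)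
Lemma greedy_lCXp e : dt_find (~~ classify T e) T (nowhere n) -> exists tau,
  greedy (enc_dt T) (enc_bool (~~ classify T e)) (enc_bool true)
    (enc_passign (of_example e)) (enc_passign (nowhere n)) (enc_nat n)
  = enc_passign tau /\
  inclusion_minimal (@set_incl n) (lCXp T e) [set f | ~~ tau f].
Proof.
set b := ~~ _ => fd.
have neq_b e' : classify T e' <> classify T e <-> classify T e' = b.
  by rewrite /b; case: (classify T e') (classify T e) => [] [].
have [||tau [-> Qtau btw maxi]] :=
    @greedyP n b true T (of_example e) (nowhere n).
- move=> tau tau' btw incl; rewrite !eqb_id => /dt_findP[e' agr cl].
  apply/dt_findP; exists e' => // f v tauf; apply: agr.
  case: (incl f) => -> //; case: (btw f) tauf => ->; first by [].
  by rewrite nowhereE.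
- by rewrite eqb_id.
exists tau; split=> //; split.
  move: Qtau; rewrite eqb_id => /dt_findP[e' agr cl].
  exists e'; split; first exact/neq_b.
  move=> f ne; rewrite inE; case: (btw f) => E; rewrite E ?nowhereE //.
  by case: ne; apply: agr; rewrite E of_exampleE.
move=> B [e' [/neq_b cl diff]] /subsetP BA; apply/setP => f.
apply/idP/idP => [/BA //|]; rewrite inE => tauf; apply/negPn/negP => fB.
(* The witness [e'] for [B] keeps the value of [e] at [f], so it still agrees with [tau] after [f]
   is fixed, and the loop must have fixed [f]. *)
suff E : tau f = of_example e f by rewrite E of_exampleE in tauf.
apply: maxi; rewrite eqb_id; apply/dt_findP; exists e' => // g v.
have e'e h : h \notin B -> e' h = e h.
  by move=> hB; apply/eqP/negPn/negP => /eqP/diff; apply/negP.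
rewrite setpE; case: eqP => [->|_ taug].
  by rewrite of_exampleE => -[<-]; apply: e'e.
have gB : g \notin B by apply/negP => /BA; rewrite inE taug.
by case: (btw g) taug => ->; rewrite ?nowhereE // of_exampleE e'e // => -[].
Qed.

End Explanations.

(** * Sizes of encoded inputs *)

Lemma size_enc_nat m : data_size (enc_nat m) = 2 * m + 1.
Proof. by elim: m => //= m ->; lia. Qed.

Lemma size_enc_bool b : data_size (enc_bool b) <= 3.
Proof. by case: b. Qed.

Lemma size_enc_dt n (T : dt n) :
  data_size (enc_dt T) <= dt_nodes T * (2 * n + 5).
Proof.
elim: T => [b|f t0 IH0 t1 IH1] /=; first by have := size_enc_bool b; lia.
rewrite size_enc_nat; have := ltn_ord f.
set K := 2 * n + 5 in IH0 IH1 *; rewrite [_.+1 * K]mulSn mulnDl.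
by rewrite {1}/K; lia.
Qed.

Lemma size_enc_example n (e : example n) :
  data_size (enc_example e) <= 4 * n + 1.
Proof.
rewrite /enc_example -[n in _ <= _ * n + _](size_enum_ord n).
by elim: (enum _) => //= f s IH; have := size_enc_bool (e f); lia.
Qed.

(** * The programs and their correctness *)

Lemma ptime_solvable (Q : search_problem) F B :
    ptime F -> polynomial B ->
    (forall x : input Q, data_size (enc_input x) <= B (input_size x)) ->
    (forall x : input Q, exists o : option (solution x),
       F (enc_input x) = enc_option enc_solution o /\ correct_answer o) ->
  solvable_in_polynomial_time Q.
Proof.
move=> [c [C [pC cP]]] pB szB FP.
have [_ [a [k leCB]]] := polynomial_comp pC pB.
exists (c 0), a, k => x; have [o [Fo ok]] := FP x.
have [s [t [ex s0 _ le_t _]]] := cP 0 (init (enc_input x)).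
exists o, s, t; split=> //; first by rewrite s0.
by apply: leq_trans le_t (leq_trans (pC.1 _ _ (szB x)) _).
Qed.

(** [mapd (Cons Nil)] turns the example into a total assignment, and [b] is the opposite class. An
    answer always exists, so the result is always a [Some]. *)
Definition lAXp_program (n T z : data) : data :=
  let e := mapd (Cons Nil) z in
  let b := notd (dfsd T trued e) in
  Cons Nil (mapd (fun v => ifd v trued Nil) (greedy T b Nil n e n)).

(** Start and target of the greedy loop are exchanged, and the final [mapd notd] takes the
    complement of the domain. *)
Definition lCXp_program (n T z : data) : data :=
  let e := mapd (Cons Nil) z in
  let b := notd (dfsd T trued e) in
  ifd (dfsd T b n) (Cons Nil (mapd notd (greedy T b trued e n n))) Nil.

Definition global_program (n T c : data) : data :=
  let r := dfsd T c n in
  ifd r (Cons Nil (greedy T (notd c) Nil n (tl r) n)) Nil.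

Ltac ptime_solve := do ?[ apply: ptime_greedy | apply: ptime_dfs
  | apply: ptime_not | ptime_step ].

Lemma ptime_options e : ptime e -> ptime (fun x => mapd (Cons Nil) (e x)).
Proof. by apply: (ptime_map (C := 2)) => [|d]; [ptime_solve|rewrite /=; lia]. Qed.

Lemma ptime_lAXp :
  ptime (fun x => lAXp_program (hd x) (hd (tl x)) (tl (tl x))).
Proof.
rewrite /lAXp_program; cbv zeta; ptime_step; first exact: ptime_nil.
apply: (ptime_map (C := 2)) => [|d|]; first by ptime_solve.
  by case: d => [|? ?] /=; lia.
by do ?[apply: ptime_options | ptime_solve].
Qed.

Lemma ptime_lCXp :
  ptime (fun x => lCXp_program (hd x) (hd (tl x)) (tl (tl x))).
Proof.
have ptime_nots f : ptime f -> ptime (fun x => mapd notd (f x)).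
  apply: (ptime_map (C := 2)) => [|d]; first by ptime_solve.
  by case: d => [|? ?] /=; lia.
rewrite /lCXp_program; cbv zeta.
by do ?[apply: ptime_nots | apply: ptime_options | ptime_solve].
Qed.

Lemma ptime_global c : ptime c ->
  ptime (fun x => global_program (hd x) (hd (tl x)) (c x)).
Proof. by rewrite /global_program; cbv zeta => pc; ptime_solve. Qed.

Lemma polynomial_input_bound :
  polynomial (fun m => 6 * m + 10 + m * (2 * m + 5)).
Proof. by auto 20 with ptime. Qed.

Lemma size_enc_local x :
  let m := local_size x in
  data_size (enc_local_input x) <= 6 * m + 10 + m * (2 * m + 5).
Proof.
case: x => n T e; rewrite /local_size /= size_enc_nat.
have := size_enc_dt T; have := size_enc_example e.
have : dt_nodes T * (2 * n + 5) <= (n + dt_nodes T) * (2 * (n + dt_nodes T) + 5).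
  by rewrite leq_mul //; lia.
by lia.
Qed.

Lemma size_enc_global x :
  let m := global_size x in
  data_size (enc_global_input x) <= 6 * m + 10 + m * (2 * m + 5).
Proof.
case: x => n T c; rewrite /global_size /= size_enc_nat.
have := size_enc_dt T; have := size_enc_bool c.
have : dt_nodes T * (2 * n + 5) <= (n + dt_nodes T) * (2 * (n + dt_nodes T) + 5).
  by rewrite leq_mul //; lia.
by lia.
Qed.

Lemma classify_dfs n (T : dt n) e :
  notd (dfsd (enc_dt T) trued (mapd (Cons Nil) (enc_example e)))
  = enc_bool (~~ classify T e).
Proof.
rewrite enc_of_example -[trued]/(enc_bool true) dfs_find.
have := dt_find_of_example true T e.
by rewrite eqb_id; case: dt_find => [s|] /= <-.
Qed.

Lemma lAXp_program_correct n (T : dt n) e : exists A,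
  lAXp_program (enc_nat n) (enc_dt T) (enc_example e) 
    = Cons Nil (enc_feature_set A) /\ inclusion_minimal (@set_incl n) (lAXp T e) A.
Proof.
have ax : gAXp T (classify T e) (of_example e).
  by move=> e' /agrees_of_example ->.
have [tau [gr incl min]] := greedy_gAXp ax.
exists [set f | tau f]; split; last exact: lAXp_of_gAXp incl min.
rewrite -enc_nowhere in gr.
rewrite /lAXp_program classify_dfs enc_of_example gr.
by congr (Cons Nil _); apply: (enc_feature_set_map (h := isSome)) => -[].
Qed.

Lemma lCXp_program_correct n (T : dt n) e :
  exists o : option {set 'I_n},
    lCXp_program (enc_nat n) (enc_dt T) (enc_example e)
      = enc_option (@enc_feature_set n) o
    /\ @correct_answer (local_problem lCXp) (LocalInput T e) o.
Proof.
rewrite /lCXp_program classify_dfs enc_of_example.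
rewrite [X in dfsd _ _ X]enc_nowhere dfs_find.
case E: (dt_find _ _ _) => [s|] /=.
  have [|tau [gr min]] := @greedy_lCXp n T e; first by rewrite E.
  rewrite -enc_nowhere in gr; exists (Some [set f | ~~ tau f]); split=> //.
  rewrite -[trued]/(enc_bool true) gr -[RHS]/(Cons Nil (enc_feature_set _)).
  by congr (Cons Nil _); apply: (enc_feature_set_map (h := fun v => ~~ v)) => -[].
exists None; split=> // A [[e' [ne _]] _].
apply: (dt_find_None E (agrees_nowhere e')).
by case: (classify T e') (classify T e) ne => [] [].
Qed.

Lemma global_program_correct n (T : dt n) c : exists o : option (passign n),
  global_program (enc_nat n) (enc_dt T) (enc_bool c)
    = enc_option (@enc_passign n) o
  /\ @correct_answer (global_problem gAXp) (GlobalInput T c) o.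
Proof.
rewrite /global_program [X in dfsd _ _ X]enc_nowhere dfs_find notd_bool.
case E: (dt_find _ _ _) => [s|] /=.
  have [_ ax] := dt_find_Some E; have [tau [gr _ min]] := greedy_gAXp ax.
  rewrite -enc_nowhere in gr; exists (Some tau); split=> //.
  by rewrite /= gr.
(* Some example agrees with the supposed explanation, and its leaf has label [c], against the failed
   search. *)
exists None; split=> // tau [ax _]; have [e agr] := agrees_ex tau.
exact: dt_find_None E (agrees_nowhere e) (ax e agr).
Qed.

Theorem theorem10 (P : explanation_type) :
  solvable_in_polynomial_time (DT_minimal_explanation P).
Proof.
have pc : ptime (fun x => tl (tl x)) by ptime_solve.
case: P.
- apply: (@ptime_solvable (local_problem lAXp) _ _
    ptime_lAXp polynomial_input_bound size_enc_local) => -[n T e] /=.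
  by have [A [-> min]] := lAXp_program_correct T e; exists (Some A).
- apply: (@ptime_solvable (local_problem lCXp) _ _
    ptime_lCXp polynomial_input_bound size_enc_local) => -[n T e].
  exact: lCXp_program_correct.
- apply: (@ptime_solvable (global_problem gAXp) _ _
    (ptime_global pc) polynomial_input_bound size_enc_global) => -[n T c].
  exact: global_program_correct.
(* The program for global abductive explanations is run on the negated class. *)
apply: (@ptime_solvable (global_problem gCXp) _ _ (ptime_global (ptime_not pc))
  polynomial_input_bound size_enc_global) => -[n T c].
rewrite -[notd _]/(notd (enc_bool c)) notd_bool.
have [o [eq_o ok]] := global_program_correct T (~~ c); exists o; split=> //.
case: o {eq_o} ok => [tau [/= ax min]|ok tau [/gCXpE ax min]].
  by split=> [|rho /gCXpE]; [apply/gCXpE|apply: min].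
by apply: (ok tau); split=> // rho /gCXpE; apply: min.
Qed.
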